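(* Let $\nu>-1$ be real with $|\nu|>1/2$, and let $f$ be a positive integrable function on $(0,1)$, satisfying $\int_0^1 t^{\nu+1/2}|f(t)|\,dt<\infty$ in the case $\nu<-1/2$, such that $t^{3/2-3|\nu|}f(t)$ is increasing for $0<t<1$. Then $$\operatorname{sgn}\left[\mathbb{H}_\nu(f)(j_{\nu,m})\right]=(-1)^{m+1},\qquad m=1,2,\dots.$$
   Context: $J_\nu$ denotes the Bessel function of the first kind of order $\nu$, and $(j_{\nu,m})_{m\ge1}$ the sequence of all positive zeros of $J_\nu$ in ascending order. The paper assumes throughout that $\nu>-1$. For $\nu>-1$, $\mathbb{J}_\nu(z)=\sum_{m=0}^\infty \frac{(-1)^m(z/2)^{2m}}{m!\,(\nu+1)_m}=\Gamma(\nu+1)(z/2)^{-\nu}J_\nu(z)$, where $(x)_m$ is the Pochhammer symbol, and $\mathbb{H}_\nu(f)(z)=\int_0^1 t^{\nu+1/2}f(t)\,\mathbb{J}_\nu(zt)\,dt$, $z\in\mathbb{C}$. *)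

(* Defs.v *)
From HB Require Import structures.
From mathcomp Require Import all_boot all_order all_algebra.
From mathcomp Require Import all_classical all_reals all_analysis.

Set Implicit Arguments.
Unset Strict Implicit.
Unset Printing Implicit Defensive.

Import Order.TTheory GRing.Theory Num.Theory.
Import numFieldNormedType.Exports.

Local Open Scope classical_set_scope.
Local Open Scope ring_scope.

(* Euler's integral; it is the Gamma function for 0 < x only. *)
Definition Gamma (R : realType) (x : R) : R :=
  \int[@lebesgue_measure R]_(t in `]0, +oo[) (t `^ (x - 1) * expR (- t)).

Definition pochhammer (R : realType) (x : R) (m : nat) : R :=
  \prod_(i < m) (x + i%:R).

(* J_nu(x), for nu > -1 (so that every Gamma argument is positive) and x > 0
   (so that (x / 2) `^ _ is the real power). *)
Definition besselJ (R : realType) (nu x : R) : R :=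
  limn (series (fun m : nat =>
    (-1) ^+ m / (m`!%:R * Gamma (m%:R + nu + 1)) * (x / 2) `^ (m.*2%:R + nu))).

(* The entire function Gamma(nu + 1) (z / 2)^(- nu) J_nu(z), restricted to the
   real line. *)
Definition besselJJ (R : realType) (nu z : R) : R :=
  limn (series (fun m : nat =>
    (-1) ^+ m * (z / 2) ^+ m.*2 / (m`!%:R * pochhammer (nu + 1) m))).

Definition hankelH (R : realType) (nu : R) (f : R -> R) (z : R) : R :=
  \int[@lebesgue_measure R]_(t in `]0, 1[)
    (t `^ (nu + 1 / 2) * f t * besselJJ nu (z * t)).

(* j 1 < j 2 < ... are all the positive zeros of J_nu; indices start at 1, so
   the value j 0 is irrelevant. *)
Definition bessel_zeros (R : realType) (nu : R) (j : nat -> R) : Prop :=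
  (forall m n : nat, (1 <= m)%N -> (m < n)%N -> j m < j n) /\
  (forall x : R, (0 < x /\ besselJ nu x = 0) <->
                 (exists2 m : nat, (1 <= m)%N & j m = x)).

(* Main.v *)
Require Import Defs.
From HB Require Import structures.
From mathcomp Require Import all_boot all_order all_algebra.
From mathcomp Require Import all_classical all_reals all_analysis.
From mathcomp Require Import measurable_realfun ring lra.
Import Order.TTheory GRing.Theory Num.Theory.
Import numFieldNormedType.Exports.
Local Open Scope classical_set_scope.
Local Open Scope ring_scope.

Set Implicit Arguments.
Unset Strict Implicit.
Unset Printing Implicit Defensive.

(* Up to a constant factor, t^(nu + 1/2) f(t) JJ_nu(z t) is
   g(t) t^(3|nu| - 1) J_nu(z t) with g(t) = t^(3/2 - 3|nu|) f(t) increasing.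
   The substitution s = t^(2|nu|) turns t^(3|nu| - 1) J_nu(z t) dt into
   const * y(s) ds, where y(s) = s^(1/2) J_nu(z s^(1/(2|nu|))) satisfies
   y'' + q y = 0 with q(s) = const * s^(1/|nu| - 2); since |nu| > 1/2, q is
   positive and strictly decreasing. Reflecting an arch of y about its right end
   c and comparing the Wronskian of y(c - r) and -y(c + r), each arch lies
   strictly below the next one (Sturm-Makai). The areas of the successive arches
   of t^(3|nu| - 1) J_nu(z t) on (0, 1), z = j_{nu,m}, thus increase, all the
   more so after multiplication by the increasing g, and the alternating sum of
   these m areas has the sign of the last one. *)

(** * Pointwise rules of differentiation and monotonicity *)

Section pointwise_derive.
Context (R : realType) (f g : R -> R) (x a b : R).
Hypotheses (fa : is_derive x (1 : R) f a) (gb : is_derive x (1 : R) g b).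

Lemma derive_addr : is_derive x (1 : R) (fun t => f t + g t) (a + b).
Proof. exact: (is_deriveD fa gb). Qed.

Lemma derive_oppr : is_derive x (1 : R) (fun t => - f t) (- a).
Proof. exact: (is_deriveN fa). Qed.

Lemma derive_subr : is_derive x (1 : R) (fun t => f t - g t) (a - b).
Proof. exact: (is_deriveB fa gb). Qed.

Lemma derive_mulr : is_derive x (1 : R) (fun t => f t * g t) (a * g x + f x * b).
Proof.
have := is_deriveM fa gb => H; apply: (is_derive_eq H).
by rewrite /GRing.scale/= addrC mulrC.
Qed.

Lemma derive_divr : g x != 0 ->
  is_derive x (1 : R) (fun t => f t / g t) ((a * g x - f x * b) / g x ^+ 2).
Proof.
move=> gx; have := is_deriveM fa (is_deriveV gx gb) => H; apply: (is_derive_eq H).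
by rewrite /GRing.scale/=; field.
Qed.

End pointwise_derive.

Lemma derive_compr (R : realType) (f g : R -> R) (x a b : R) :
  is_derive (g x) (1 : R) f a -> is_derive x (1 : R) g b ->
  is_derive x (1 : R) (fun t => f (g t)) (a * b).
Proof. exact: is_derive1_comp. Qed.

Lemma is_derive_near_right (R : realType) (f : R -> R) (x d : R) :
  is_derive x (1 : R) f d -> 0 < d -> \forall r \near 0^'+, f x < f (x + r).
Proof.
move=> [fx fxd] d0.
have fl : h^-1 *: (f (h *: (1 : R) + x) - f x) @[h --> 0^'] --> d by rewrite -fxd; exact: fx.
have /cvgr_gt /(_ 0 d0) fl0 := cvg_dnbhs_at_right fl.
near=> r.
have r0 : 0 < r by near: r; exact: nbhs_right_gt.
have : 0 < r^-1 *: (f (r *: (1 : R) + x) - f x) by near: r; exact: fl0.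
by rewrite scaler1 /= pmulr_rgt0 ?invr_gt0// subr_gt0 addrC.
Unshelve. all: by end_near. Qed.

(** Mean value theorem. The derivative may vanish at the ends, as that of the Wronskian [W] below
    does at 0. *)
Lemma is_derive_lt (R : realType) (f df : R -> R) (x y : R) : x < y ->
  (forall t : R, x <= t <= y -> is_derive t (1 : R) f (df t)) ->
  (forall t, x < t < y -> 0 < df t) -> f x < f y.
Proof.
move=> xy fd df0.
have [t|t|t txy] := @MVT R f df x y xy.
- by rewrite in_itv/= => /andP[xt ty]; apply: fd; rewrite !ltW.
- apply: derivable_within_continuous => u; rewrite in_itv/= => uxy.
  by have [] := fd _ uxy.
- move=> fxy; rewrite -subr_gt0 fxy mulr_gt0 ?subr_gt0//.
  by apply: df0; move: txy; rewrite in_itv.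
Qed.

(** * Sturm comparison of consecutive arches *)

Section sturm.
Context (R : realType) (q y v Psi : R -> R).
Hypothesis y_derive : forall s : R, 0 < s -> is_derive s (1 : R) y (v s).
Hypothesis v_derive : forall s : R, 0 < s -> is_derive s (1 : R) v (- (q s * y s)).
Hypothesis q_gt0 : forall s, 0 < s -> 0 < q s.
Hypothesis q_decr : forall s t, 0 < s -> s < t -> q t < q s.
Hypothesis Psi_derive : forall s : R, 0 < s -> is_derive s (1 : R) Psi (y s).

Let Ny_derive (s : R) : 0 < s -> is_derive s (1 : R) (\- y) (- v s).
Proof. by move=> s0; have := y_derive s0 => ?; apply: is_deriveN. Qed.

(** Where [y] is positive it is concave, so [v] decreases there. If [v c] were nonnegative, [v]
    would be positive on the whole arch and [y] would increase to [y c = 0]. *)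
Lemma sturm_slope_lt0 a c : 0 <= a -> a < c ->
  (forall s, a < s < c -> 0 < y s) -> y c = 0 -> v c < 0.
Proof.
move=> a0 ac y0 yc; rewrite ltNge; apply/negP => vc.
have v_lt s : a < s < c -> 0 < v s.
  move=> /andP[as_ sc]; rewrite -oppr_lt0.
  apply: (@lt_le_trans _ _ (- v c)); last by rewrite oppr_le0.
  apply: (@is_derive_lt _ (\- v) (fun s => q s * y s)) => // t /andP[st tc].
    have t0 : 0 < t by rewrite (le_lt_trans a0)// (lt_le_trans as_).
    have := v_derive t0 => vt; rewrite -[q t * y t]opprK; exact: is_deriveN.
  have t0 : 0 < t by rewrite (le_lt_trans a0)// (lt_trans as_).
  by rewrite mulr_gt0// ?q_gt0// y0// tc (lt_trans as_).
pose s := (a + c) / 2.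
have sac : a < s < c by rewrite /s; lra.
have : y s < y c.
  apply: (@is_derive_lt _ y v); first by case/andP: sac.
    move=> t /andP[st tc]; apply: y_derive.
    by rewrite (le_lt_trans a0)// (lt_le_trans _ st)//; case/andP: sac.
  by move=> t /andP[st tc]; apply: v_lt; rewrite tc andbT (lt_trans _ st)//; case/andP: sac.
by rewrite yc ltNge ltW// y0.
Qed.

(** The negative slope at [c] makes [y] negative just after [c]; a positive value further on would,
    by the intermediate value theorem, force a zero inside the arch. *)
Lemma sturm_alternate a c b : 0 <= a -> a < c -> c < b ->
  (forall s, a < s < c -> 0 < y s) -> y c = 0 ->
  (forall s, c < s < b -> y s != 0) -> forall s, c < s < b -> y s < 0.
Proof.
move=> a0 ac cb y0 yc yn s scb; have /andP[cs sb] := scb.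
have c0 : 0 < c by exact: le_lt_trans ac.
have vc := sturm_slope_lt0 a0 ac y0 yc.
rewrite lt_neqAle yn//= leNgt; apply/negP => ys.
have : \forall r \near 0^'+, (\- y) c < (\- y) (c + r).
  by apply: is_derive_near_right (Ny_derive c0) _; rewrite oppr_gt0.
move=> H.
near (0:R)^'+ => r.
have r0 : 0 < r by near: r; exact: nbhs_right_gt.
have rs : r < s - c by near: r; apply: nbhs_right_lt; rewrite subr_gt0.
have : (\- y) c < (\- y) (c + r) by near: r.
rewrite /= yc oppr0 oppr_gt0 => ycr.
have [|||t] := @IVT R y (c + r) s 0.
- lra.
- apply: derivable_within_continuous => t; rewrite in_itv/= => /andP[crt _].
  by have [] : is_derive t (1 : R) y (v t) by apply: y_derive; lra.
- by rewrite min_l ?max_r ?(ltW ycr) ?(ltW ys)// ?(le_trans (ltW ycr))// ltW.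
- rewrite in_itv/= => /andP[crt ts] yt.
  have : y t != 0 by apply: yn; lra.
  by rewrite yt eqxx.
Unshelve. all: by end_near. Qed.

(** The Wronskian of [- y (c + r)] and [y (c - r)] as functions of [r]. In its derivative the
    products of two values of [v] cancel, leaving a difference of values of [q] as a factor. *)
Let W c r := - v (c + r) * y (c - r) - y (c + r) * v (c - r).

Let add_derive (f df : R -> R) (c r : R) : is_derive (c + r) (1 : R) f (df (c + r)) ->
  is_derive r (1 : R) (fun r => f (c + r)) (df (c + r)).
Proof.
move=> fd.
rewrite -[df _]mulr1; apply: (derive_compr (g := fun r => c + r)) fd _.
apply: (is_derive_eq (derive_addr (is_derive_cst c _ _) (is_derive_id _ _))).
exact: add0r.
Qed.

Let sub_derive (f df : R -> R) (c r : R) : is_derive (c - r) (1 : R) f (df (c - r)) ->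
  is_derive r (1 : R) (fun r => f (c - r)) (- df (c - r)).
Proof.
move=> fd.
rewrite -[- df _]mulrN1; apply: (derive_compr (g := fun r => c - r)) fd _.
apply: (is_derive_eq (derive_subr (is_derive_cst c _ _) (is_derive_id _ _))).
exact: add0r.
Qed.

(* By the Wronskian [W], the quotient - y(c + r) / y(c - r) increases; it tends
   to 1 as r -> 0. *)
Lemma sturm_reflect c L : L <= c ->
  (forall r, 0 < r < L -> 0 < y (c - r)) -> y c = 0 -> v c < 0 ->
  (forall r, 0 < r < L -> y (c + r) < 0) ->
  forall r, 0 < r < L -> y (c - r) < - y (c + r).
Proof.
move=> Lc ym yc vc yp.
have W_derive r : - c < r < c -> is_derive r (1 : R) (W c)
    ((q (c + r) - q (c - r)) * (y (c + r) * y (c - r))).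
  move=> rc.
  have yd1 := add_derive (y_derive (_ : 0 < c + r)).
  have vd1 := add_derive (df := fun s => - (q s * y s)) (v_derive (_ : 0 < c + r)).
  have yd2 := sub_derive (y_derive (_ : 0 < c - r)).
  have vd2 := sub_derive (df := fun s => - (q s * y s)) (v_derive (_ : 0 < c - r)).
  have {}yd1 := yd1 ltac:(lra); have {}vd1 := vd1 ltac:(lra).
  have {}yd2 := yd2 ltac:(lra); have {}vd2 := vd2 ltac:(lra).
  apply: (is_derive_eq (derive_subr (derive_mulr (derive_oppr vd1) yd2) (derive_mulr yd1 vd2))).
  ring.
have W0 r : 0 < r < L -> 0 < W c r.
  move=> rL; have <- : W c 0 = 0 by rewrite /W addr0 subr0 yc mulr0 mul0r subrr.
  apply: is_derive_lt; [by case/andP: rL|..].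
    by move=> t tr; apply: W_derive; lra.
  move=> t tr /=; rewrite nmulr_rgt0; first by rewrite nmulr_rlt0 ?ym ?yp; lra.
  by rewrite subr_lt0; apply: q_decr; lra.
have ratio_derive r : 0 < r < L ->
    is_derive r (1 : R) (fun r => - y (c + r) / y (c - r)) (W c r / (y (c - r)) ^+ 2).
  move=> rL; have ym0 : y (c - r) != 0 by rewrite gt_eqF ?ym.
  have yd1 := add_derive (y_derive (_ : 0 < c + r)).
  have yd2 := sub_derive (y_derive (_ : 0 < c - r)).
  have {}yd1 := yd1 ltac:(lra); have {}yd2 := yd2 ltac:(lra).
  apply: (is_derive_eq (derive_divr (derive_oppr yd1) yd2 ym0)).
  by rewrite /W; congr (_ / _); ring.
have ratio_lt r s : 0 < r -> r < s -> s < L -> - y (c + r) / y (c - r) < - y (c + s) / y (c - s).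
  move=> r0 rs sL.
  apply: (is_derive_lt (f := fun r => - y (c + r) / y (c - r))
    (df := fun r => W c r / (y (c - r)) ^+ 2)) => // t /andP[rt ts].
    by apply: ratio_derive; lra.
  by rewrite divr_gt0 ?W0 ?exprn_gt0 ?ym; lra.
(* The quotient is 0 / 0 at 0, so its limit there is avoided. If it were at most 1 at [r], its value
   [k] at [r / 2] would be below 1, while [- y (c + r) - k * y (c - r)] has derivative
   [(k - 1) * v c > 0] at 0, which puts the quotient above [k] near 0, against its increase. *)
move=> r rL; rewrite ltNge; apply/negP => yr.
pose k := - y (c + r / 2) / y (c - r / 2).
have k1 : k < 1.
  apply: (@lt_le_trans _ _ (- y (c + r) / y (c - r))).
    by apply: ratio_lt; lra.
  by rewrite ler_pdivrMr ?mul1r// ym.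
have c0 : 0 < c by lra.
have hd : is_derive (0:R) (1 : R) (fun r => - y (c + r) - k * y (c - r)) ((k - 1) * v c).
  have yd1 := add_derive (c := c) (r := 0) (y_derive (_ : 0 < c + 0)).
  have yd2 := sub_derive (c := c) (r := 0) (y_derive (_ : 0 < c - 0)).
  have {}yd1 := yd1 ltac:(lra); have {}yd2 := yd2 ltac:(lra).
  apply: (is_derive_eq (derive_subr (derive_oppr yd1) (derive_mulr (is_derive_cst k _ _) yd2))).
  rewrite addr0 subr0 /cst; ring.
have := is_derive_near_right hd; rewrite nmulr_lgt0// subr_lt0 => /(_ k1) H.
near (0:R)^'+ => t.
have t0 : 0 < t by near: t; exact: nbhs_right_gt.
have tr : t < r / 2 by near: t; apply: nbhs_right_lt; lra.
have : - y (c + 0) - k * y (c - 0) < - y (c + (0 + t)) - k * y (c - (0 + t)) by near: t.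
rewrite addr0 subr0 add0r yc mulr0 oppr0 addr0 subr_gt0 -ltr_pdivlMr ?ym; last lra.
apply/negP; rewrite -leNgt ltW// ratio_lt//; lra.
Unshelve. all: by end_near. Qed.

Lemma sturm_arch a c b : 0 <= a -> a < c -> c < b ->
  (forall s, a < s < c -> 0 < y s) -> y c = 0 ->
  (forall s, c < s < b -> y s != 0) -> y b = 0 ->
  Psi x @[x --> a^'+] --> Psi a ->
  Psi c - Psi a < Psi c - Psi b.
Proof.
move=> a0 ac cb y0 yc yn yb Pa.
have c0 : 0 < c by exact: le_lt_trans ac.
have yneg := sturm_alternate a0 ac cb y0 yc yn.
have vc := sturm_slope_lt0 a0 ac y0 yc.
have cmp L : L <= c - a -> L <= b - c -> forall r, 0 < r < L -> y (c - r) < - y (c + r).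
  by move=> La Lb; apply: sturm_reflect => // [|r rL|r rL]; [lra|apply: y0; lra|apply: yneg; lra].
(* If the right arch were shorter, then at [r = b - c] the sum [y (c - r) + y (c + r)] would be
   positive, hence also for slightly smaller [r], against [cmp]. *)
have acb : c - a <= b - c.
  rewrite leNgt; apply/negP => bac.
  have yb' : 0 < y (c - (b - c)) by apply: y0; lra.
  have cy (f df : R -> R) t : is_derive t (1 : R) f (df t) -> f x @[x --> t] --> f t.
    by move=> [dft _]; apply: differentiable_continuous; exact/derivable1_diffP.
  have d1 := add_derive (c := c) (r := b - c) (y_derive (_ : 0 < c + (b - c))).
  have d2 := sub_derive (c := c) (r := b - c) (y_derive (_ : 0 < c - (b - c))).
  have {}d1 := d1 ltac:(lra); have {}d2 := d2 ltac:(lra).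
  have d : is_derive (b - c) (1 : R) (fun r => y (c - r) + y (c + r))
    (- v (c - (b - c)) + v (c + (b - c))).
    exact: derive_addr.
  have := cy _ (fun=> - v (c - (b - c)) + v (c + (b - c))) _ d.
  have cbc : c + (b - c) = b by ring.
  rewrite cbc yb addr0 => /cvg_at_left_filter /cvgr_gt /(_ _ yb') H.
  near (b - c)^'- => r.
  have r0 : 0 < r by near: r; apply: nbhs_left_gt; lra.
  have rb : r < b - c by near: r; apply: nbhs_left_lt.
  have : 0 < y (c - r) + y (c + r) by near: r.
  by have := cmp (b - c) (ltW bac) (lexx _) r; rewrite r0 rb => /(_ isT); lra.
(* Area of the right arch minus area of the left one, both within distance [r] of [c]. *)
pose G r := Psi (c - r) - Psi (c + r).
pose L := c - a.
have G_derive r : - c < r < c -> is_derive r (1 : R) G (- y (c + r) - y (c - r)).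
  move=> rc.
  have d1 := add_derive (c := c) (r := r) (Psi_derive (_ : 0 < c + r)).
  have d2 := sub_derive (c := c) (r := r) (Psi_derive (_ : 0 < c - r)).
  have {}d1 := d1 ltac:(lra); have {}d2 := d2 ltac:(lra).
  apply: (is_derive_eq (derive_subr d2 d1)).
  ring.
have G_lt r s : 0 <= r -> r < s -> s < L -> G r < G s.
  move=> r0 rs sL; apply: (is_derive_lt rs) => t trs.
    by apply: G_derive; rewrite /L in sL; lra.
  by rewrite /= subr_gt0 (cmp L)// /L; rewrite /L in sL; lra.
have GL : 0 < G (L / 2).
  have -> : 0 = G 0 by rewrite /G addr0 subr0; ring.
  by apply: G_lt; rewrite /L; lra.
have Psib s : c <= s -> s < b -> Psi b <= Psi s.
  move=> cs sb; rewrite -lerN2 ltW//.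
  apply: (is_derive_lt (f := \- Psi) (df := fun s => - y s) sb) => t tsb.
    have t0 : 0 < t by lra.
    have := Psi_derive t0 => ?; exact: is_deriveN.
  by rewrite oppr_gt0; apply: yneg; lra.
(* The fixed gap [G (L / 2)] keeps the inequality strict when [s] tends to [a]. *)
suff : Psi b + G (L / 2) <= Psi a by lra.
apply: (closed_cvg (fun x => Psi b + G (L / 2) <= x)) Pa.
  exact: closed_ge.
near=> s.
have as_ : a < s by near: s; exact: nbhs_right_gt.
have sc : s < a + L / 2 by near: s; apply: nbhs_right_lt; rewrite /L; lra.
have : G (L / 2) < G (c - s) by apply: G_lt; rewrite /L in sc *; lra.
have : Psi b <= Psi (c + (c - s)) by apply: Psib; rewrite /L in sc; lra.
have -> : G (c - s) = Psi s - Psi (c + (c - s)) by rewrite /G; congr (Psi _ - _); ring.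
lra.
Unshelve. all: by end_near. Qed.

End sturm.

Lemma is_derive_continuous (R : realType) (f : R -> R) (x d : R) :
  is_derive x (1 : R) f d -> {for x, continuous f}.
Proof. by move=> [fx _]; apply: differentiable_continuous; exact/derivable1_diffP. Qed.

(** * The functional equation of Gamma *)

(** Equivalent to [ln u <= u] at [u = t / (2 * x)]; half of the exponential decay will absorb the
    power. *)
Lemma powR_le_expR (R : realType) (x t : R) : 0 < x -> 0 < t ->
  t `^ x <= (2 * x) `^ x * expR (t / 2).
Proof.
move=> x0 t0; have x20 : 0 < 2 * x by rewrite mulr_gt0.
rewrite /powR !gt_eqF// -expRD ler_expR -lerBlDl -mulrBr -ln_div//.
rewrite mulrC -ler_pdivlMr// (le_trans (ltW (ln_sublinear _)))//.
  by rewrite divr_gt0.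
by rewrite invfM mulrA.
Qed.

Section gamma.
Context (R : realType).
Local Notation mu := (@lebesgue_measure R).

(** The exponent is shifted by one: [I x] is Euler's integral at [x + 1], as an extended real. *)
Let k (x t : R) := t `^ x * expR (- t).
Let I x := (\int[mu]_(t in `]0%R, +oo[) (k x t)%:E)%E.

Let k_derive (x t : R) : 0 < t -> is_derive t (1 : R) (k x) (x * k (x - 1) t - k x t).
Proof.
move=> t0; have d1 := is_derive1_powR x t0.
have d2 : is_derive t (1 : R) (fun t => expR (- t)) (expR (- t) * - 1).
  exact: (derive_compr (g := fun t => - t) (is_derive_expR _) (derive_oppr (is_derive_id _ _))).
apply: (is_derive_eq (derive_mulr d1 d2)); rewrite /k; ring.
Qed.

Let k_continuous (x t : R) : 0 < t -> {for t, continuous (k x)}.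
Proof. by move=> /(k_derive x)/is_derive_continuous. Qed.

Let k_ge0 (x t : R) : 0 <= k x t.
Proof. by rewrite mulr_ge0 ?powR_ge0 ?expR_ge0. Qed.

(* The integrand may be singular at 0, so integration by parts is performed on
   compact subintervals of ]0, +oo[. *)
Let D (n : nat) : set R := `[n.+2%:R^-1, n.+2%:R].

Let D_gt0 n t : D n t -> 0 < t.
Proof. by rewrite /D/= in_itv/= => /andP[+ _]; apply: lt_le_trans; rewrite invr_gt0. Qed.

Let D_nd : nondecreasing_seq D.
Proof.
apply/nondecreasing_seqP => n; rewrite subsetEset => t; rewrite /D/= !in_itv/= => /andP[nt tn].
rewrite (le_trans _ nt) ?(le_trans tn) ?ler_nat//.
by rewrite lef_pV2 ?posrE// ler_nat.
Qed.

Let D_cup : \bigcup_n D n = `]0, +oo[%classic.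
Proof.
apply/seteqP; split=> [t [n _ /D_gt0]|t]; rewrite /= in_itv/= andbT// => t0.
pose N := (Num.truncn (Num.max t t^-1)).+1.
exists N => //; rewrite /D/= in_itv/=.
have tN : Num.max t t^-1 < N%:R by exact: truncnS_gt.
move: tN; rewrite gt_max => /andP[tN tN'].
have N2 : N%:R <= N.+2%:R :> R by by rewrite ler_nat -addn2 leq_addr.
rewrite -[leLHS]/(_^-1) -[X in _ <= X <= _]invrK lef_pV2 ?posrE ?invr_gt0// invrK.
by rewrite (le_trans (ltW tN'))//= (le_trans (ltW tN)).
Qed.

Let k_within (x : R) n : {within D n, continuous (k x)}.
Proof.
by apply: continuous_in_subspaceT => t /[!inE] /D_gt0; exact: k_continuous.
Qed.

Let k_integrable (x : R) n : mu.-integrable (D n) (EFin \o k x).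
Proof. by apply: continuous_compact_integrable; [exact: segment_compact|exact: k_within]. Qed.

Let k_measurable x (A : set R) : measurable A -> measurable_fun A (EFin \o k x).
Proof.
move=> mA; apply/measurable_EFinP; apply: measurable_funM.
  by apply: measurable_funTS; exact: measurable_powR.
by apply: measurable_funTS; apply: measurableT_comp; [exact: measurable_expR|exact: oppr_measurable].
Qed.

Let I_cvg x : (\int[mu]_(t in D n) (k x t)%:E)%E @[n --> \oo] --> I x.
Proof.
rewrite /I -D_cup; apply: ge0_nondecreasing_set_cvg_integral => //.
- by move=> i; exact: measurable_itv.
- by move=> i; apply: k_measurable; exact: measurable_itv.
- by move=> i t _; rewrite lee_fin.
Qed.

Let SS_cvgy : (n.+2%:R : R) @[n --> \oo] --> +oo.
Proof.
apply/cvgryPge => M; have /cvgryPge /(_ M) := @cvgr_idn R.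
by apply: filterS => n /le_trans; apply; rewrite ler_nat -addn2 leq_addr.
Qed.

Let boundary_cvg (x : R) : 0 < x -> (k x n.+2%:R - k x n.+2%:R^-1) @[n --> \oo] --> (0 : R).
Proof.
move=> x0; rewrite -[X in _ --> X]subr0; apply: cvgB.
  apply: (@squeeze_cvgr _ _ _ _ (fun=> 0) (fun n => (2 * x) `^ x * expR (- (n.+2%:R / 2)))).
  - near=> n; rewrite k_ge0/= /k; have := powR_le_expR x0 (ltr0Sn R n.+1).
    move=> /(ler_wpM2r (expR_ge0 (- n.+2%:R))) /le_trans; apply.
    by rewrite -mulrA -expRD; rewrite ler_wpM2l ?powR_ge0// ler_expR; lra.
  - exact: cvg_cst.
  - rewrite -[X in _ --> X](mulr0 ((2 * x) `^ x)); apply: cvgMl_tmp.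
    have H : (n.+2%:R / 2 : R) @[n --> \oo] --> +oo.
      apply/cvgryPge => M; have /cvgryPge := SS_cvgy; move/(_ (M * 2)).
      by apply: filterS => n; rewrite ler_pdivlMr.
    exact: cvg_comp H (@cvgr_expR R).
apply: (@squeeze_cvgr _ _ _ _ (fun=> 0) (fun n => (n.+2%:R^-1) `^ x)).
- near=> n; rewrite k_ge0/= /k ler_piMr ?powR_ge0// expR_le1 oppr_le0 ?invr_ge0//.
- exact: cvg_cst.
- have /cvg_at_rightP := powR_cvg0 x0; apply; split=> [n|]; first by rewrite invr_gt0.
  by apply/gtr0_cvgV0; [near=> n|exact: SS_cvgy].
Unshelve. all: by end_near. Qed.

(** Integration by parts on each [D n], then the limit. Extended reals are used since the finiteness
    of [I (x - 1)], whose integrand may blow up at 0, is deduced from this identity. *)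
Let I_succ (x : R) : 0 < x -> (x%:E * I (x - 1) = I x)%E.
Proof.
move=> x0.
have E n : (x%:E * \int[mu]_(t in D n) (k (x - 1) t)%:E =
    \int[mu]_(t in D n) (k x t)%:E + (k x n.+2%:R - k x n.+2%:R^-1)%:E)%E.
  have ab : n.+2%:R^-1 < n.+2%:R :> R.
    by rewrite (@lt_trans _ _ 1) ?invf_lt1// ltr1n.
  have ik := k_integrable x n; have ik1 := k_integrable (x - 1) n.
  have ik1x : mu.-integrable (D n) (fun t => (x * k (x - 1) t)%:E).
    under eq_fun do rewrite EFinM; apply: integrableZl => //; exact: measurable_itv.
  have FTC : (\int[mu]_(t in D n) ((x * k (x - 1) t)%:E - (k x t)%:E)
      = (k x n.+2%:R)%:E - (k x n.+2%:R^-1)%:E)%E.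
    apply: (continuous_FTC2 (f := fun t => x * k (x - 1) t - k x t)) => //.
    - apply: continuous_in_subspaceT => t /[!inE] /D_gt0 t0.
      by apply: cvgB; [apply: cvgMr|]; exact: k_continuous.
    - split.
      + move=> t; rewrite in_itv/= => /andP[nt _].
        by have [] := k_derive x (lt_trans _ nt).
      + by apply: cvg_at_right_filter; exact: k_continuous.
      + by apply: cvg_at_left_filter; exact: k_continuous.
    - move=> t; rewrite in_itv/= => /andP[nt _].
      have [] := k_derive x (lt_trans _ nt) => //.
      by rewrite derive1E.
  rewrite EFinB -FTC -integralZl//; last exact: measurable_itv.
  rewrite integralB//; last exact: measurable_itv.
  by rewrite addeC subeK//; apply: integrable_fin_num ik; exact: measurable_itv.
have c1 : (x%:E * \int[mu]_(t in D n) (k (x - 1) t)%:E @[n --> \oo] --> x%:E * I (x - 1))%E.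
  by apply: cvgeZl; [|exact: I_cvg].
have c2 : (\int[mu]_(t in D n) (k x t)%:E + (k x n.+2%:R - k x n.+2%:R^-1)%:E
    @[n --> \oo] --> I x + 0%:E)%E.
  apply: cvgeD; [exact: fin_num_adde_defl|exact: I_cvg|].
  by apply: cvg_EFin; [near=> n|exact: boundary_cvg].
rewrite adde0 in c2; rewrite -(cvg_lim (@ereal_hausdorff R) c1).
by apply/cvg_lim => //; under eq_fun do rewrite E.
Unshelve. all: by end_near. Qed.

Let I_lty (x : R) : 0 < x -> (I x < +oo)%E.
Proof.
move=> x0.
(* The factor 2 offsets the normalisation of the exponential density of rate 1/2, whose total mass
   is 1. *)
have E : (I x <= ((2 * x) `^ x * 2)%:E * \int[mu]_(t in `]0%R, +oo[) (exponential_pdf 2^-1 t)%:E)%E.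
  rewrite -ge0_integralZl//=; last 3 first.
  - by apply: measurable_funTS; apply/measurable_EFinP; exact: measurable_exponential_pdf.
  - by move=> t _; rewrite lee_fin exponential_pdf_ge0.
  - by rewrite lee_fin mulr_ge0 ?powR_ge0.
  apply: ge0_le_integral => //.
  - by move=> t _; rewrite lee_fin.
  - exact: k_measurable.
  - apply: measurable_funTS; apply/measurable_EFinP; apply: measurable_funM => //.
    exact: measurable_exponential_pdf.
  - move=> t; rewrite /= in_itv/= andbT => t0; rewrite -EFinM lee_fin exponential_pdfE; last exact: ltW.
    rewrite /k. apply: (le_trans (ler_wpM2r (expR_ge0 _) (powR_le_expR x0 t0))).
    rewrite -!mulrA mulVKf// ler_wpM2l ?powR_ge0// -expRD ler_expR; lra.
apply: (le_lt_trans E); apply: (@le_lt_trans _ _ (((2 * x) `^ x * 2)%:E * 1)%E); last by rewrite mule1 ltry.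
apply: lee_wpmul2l; first by rewrite lee_fin mulr_ge0 ?powR_ge0.
rewrite -(integral_exponential_pdf (rate := 2^-1)) ?invr_gt0//.
apply: ge0_subset_integral => //.
  by apply/measurable_EFinP; exact: measurable_exponential_pdf.
by move=> t _; rewrite lee_fin exponential_pdf_ge0.
Qed.

(** [I x] is finite and equals [x * I (x - 1)], which rules out an infinite [I (x - 1)]. *)
Let I_fin (x : R) : 0 < x -> I (x - 1) \is a fin_num.
Proof.
move=> x0; have Igt : (0 <= I (x - 1))%E by apply: integral_ge0 => t _; rewrite lee_fin.
rewrite ge0_fin_numE//; have := I_lty x0; rewrite -I_succ//.
move: Igt; case: (I (x - 1)) => [r _ _|_|//]; first by rewrite ltry.
by rewrite gt0_muley ?lte_fin.
Qed.

Lemma GammaS (x : R) : 0 < x -> Gamma (x + 1) = x * Gamma x.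
Proof.
move=> x0; rewrite /Gamma /Rintegral addrK -/(I x) -I_succ// fineM//.
exact: I_fin.
Qed.

Lemma Gamma_gt0 (x : R) : 0 < x -> 0 < Gamma x.
Proof.
move=> x0; rewrite /Gamma /Rintegral -/(I (x - 1)); apply: fine_gt0.
rewrite andbC -ge0_fin_numE ?I_fin//; last by apply: integral_ge0 => t _; rewrite lee_fin.
(* On the interval from 1 to 2, [x - 1 > -1] bounds the power below by 1/t, hence by 1/2, and the
   exponential is at least [expR (-2)]. *)
have I12 : (\int[mu]_(t in `[1%R, 2%R]) ((2^-1 * expR (-2))%:E) <= I (x - 1))%E.
  apply: (@le_trans _ _ (\int[mu]_(t in `[1%R, 2%R]) (k (x - 1) t)%:E)%E).
    apply: ge0_le_integral => //.
    - apply: (@k_measurable (x - 1) `[1, 2]); exact: measurable_itv.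
    - move=> t; rewrite /= in_itv/= => /andP[t1 t2]; rewrite lee_fin ler_pM ?expR_ge0 ?invr_ge0//.
        rewrite (@le_trans _ _ (t `^ (-1)))//; last by apply: ler_powR => //; lra.
        by rewrite powR_inv1 ?lef_pV2 ?posrE; lra.
      by rewrite ler_expR lerN2.
  apply: ge0_subset_integral => //; first exact: k_measurable.
    by move=> t _; rewrite lee_fin.
  by move=> t; rewrite /= !in_itv/= andbT => /andP[+ _]; apply: lt_le_trans.
rewrite (lt_le_trans _ I12)//= integral_cst//= lebesgue_measure_itv/= lte_fin.
rewrite ltr1n/= -EFinD -EFinM lte_fin mulr_gt0 ?mulr_gt0 ?expR_gt0 ?invr_gt0//; lra.
Qed.
End gamma.

(** * The Bessel power series *)

Section pochhammer.
Context (R : realType).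
Implicit Types x : R.

Lemma pochhammerSr x m : pochhammer x m.+1 = pochhammer x m * (x + m%:R).
Proof. by rewrite /pochhammer big_ord_recr. Qed.

Lemma pochhammerSl x m : pochhammer x m.+1 = x * pochhammer (x + 1) m.
Proof.
rewrite /pochhammer big_ord_recl addr0; congr (_ * _).
by apply: eq_bigr => i _; rewrite -addrA nat1r.
Qed.

Lemma pochhammer_gt0 x m : 0 < x -> 0 < pochhammer x m.
Proof. by move=> x0; apply: prodr_gt0 => i _; rewrite ltr_pwDl. Qed.

Lemma pochhammer_ge x m : 0 < x -> x <= pochhammer x m.+1.
Proof.
move=> x0; elim: m => [|m IHm]; first by rewrite pochhammerSr addr0 /pochhammer big_ord0 mul1r.
rewrite pochhammerSr (le_trans IHm)// ler_peMr ?(ltW (pochhammer_gt0 _ _))//.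
by rewrite -natr1 addrA lerDr addr_ge0// ltW.
Qed.

(** The first summand serves [m = 0], the second [m > 0]. Uniformity in [m] lets the exponential
    series dominate the Bessel series. *)
Lemma pochhammerV_le x m : 0 < x -> (pochhammer x m)^-1 <= 1 + x^-1.
Proof.
move=> x0; case: m => [|m]; first by rewrite /pochhammer big_ord0 invr1 lerDl invr_ge0 ltW.
rewrite (@le_trans _ _ x^-1) ?lerDr//.
by rewrite lef_pV2 ?posrE ?pochhammer_gt0// pochhammer_ge.
Qed.

Lemma Gamma_pochhammer x m : 0 < x -> Gamma (x + m%:R) = pochhammer x m * Gamma x.
Proof.
move=> x0; elim: m => [|m IHm]; first by rewrite addr0 /pochhammer big_ord0 mul1r.
rewrite -natr1 addrA GammaS; last by rewrite ltr_pwDl.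
by rewrite IHm pochhammerSr mulrCA mulrA.
Qed.

End pochhammer.

Section bessel_series.
Context (R : realType).
Implicit Types nu u x z : R.

Definition bessel_coef nu (m : nat) : R := (-1) ^+ m / (m`!%:R * pochhammer (nu + 1) m).

(* JJ_nu(z) = besselP nu (z^2 / 4). *)
Definition besselP nu u : R := limn (pseries (bessel_coef nu) u).

Lemma scale_seqE (k : R) (c : R^nat) m : (k *: c) m = k * c m.
Proof. by []. Qed.

Lemma is_cvg_bessel_series nu u : -1 < nu -> cvgn (pseries (bessel_coef nu) u).
Proof.
move=> nu1; have n0 : 0 < nu + 1 by lra.
apply: normed_cvg; rewrite /normed_series_of/=.
apply: (@series_le_cvg _ _ ((1 + (nu + 1)^-1) *: exp_coeff `|u|)) => [//|n|n|].
- by rewrite mulr_ge0 ?exp_coeff_ge0// addr_ge0// invr_ge0 ltW.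
- rewrite !normrM normrX normrN1 expr1n mul1r normfV normrM normr_nat normrX.
  rewrite (gtr0_norm (pochhammer_gt0 _ n0)) invfM mulrAC mulrC.
  rewrite scale_seqE /exp_coeff/= [X in _ <= _ * X]mulrC.
  by rewrite ler_wpM2r ?pochhammerV_le// mulr_ge0 ?invr_ge0.
- by apply: is_cvg_seriesZ; exact: is_cvg_series_exp_coeff.
Qed.

(** Termwise differentiation raises the order by one, up to a factor, so the convergence of the
    derived series is again that of Bessel series. *)
Lemma bessel_coef_diffs nu : -1 < nu ->
  pseries_diffs (bessel_coef nu) = (- (nu + 1)^-1) *: bessel_coef (nu + 1).
Proof.
move=> nu1; have n0 : 0 < nu + 1 by lra.
apply/funext => m; rewrite /pseries_diffs /bessel_coef pochhammerSl factS natrM exprS/=.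
have fm : (m`!%:R : R) != 0 by rewrite pnatr_eq0 -lt0n fact_gt0.
have pm : pochhammer (nu + 1 + 1) m != 0 by rewrite gt_eqF ?pochhammer_gt0; lra.
rewrite scale_seqE -nat1r; field.
by rewrite pm fm gt_eqF//= nat1r pnatr_eq0.
Qed.

Lemma pseriesZ (k : R) (c : R^nat) u : pseries (k *: c) u = k *: pseries c u.
Proof.
apply/funext => n; rewrite scale_seqE /pseries /series/= mulr_sumr.
by apply: eq_bigr => i _; rewrite scale_seqE mulrA.
Qed.

Lemma pseries_diffsZ (k : R) (c : R^nat) : pseries_diffs (k *: c) = k *: pseries_diffs c.
Proof. by apply/funext => n; rewrite scale_seqE /pseries_diffs scale_seqE mulrCA. Qed.

Lemma besselP_derive nu u : -1 < nu ->
  is_derive u (1 : R) (besselP nu) (- (nu + 1)^-1 * besselP (nu + 1) u).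
Proof.
move=> nu1; have nu2 : -1 < nu + 1 by lra.
have nu3 : -1 < nu + 1 + 1 by lra.
have c2 K : cvgn (pseries (bessel_coef (nu + 1)) K) by exact: is_cvg_bessel_series.
have H : is_derive u (1 : R) (besselP nu) (limn (pseries (pseries_diffs (bessel_coef nu)) u)).
  apply: (@pseries_snd_diffs _ _ (`|u| + 1)); rewrite ?bessel_coef_diffs// ?pseries_diffsZ
    ?bessel_coef_diffs// ?pseriesZ.
  - exact: is_cvg_bessel_series.
  - by apply: is_cvgZl_tmp; exact: c2.
  - by do 2 apply: is_cvgZl_tmp; exact: is_cvg_bessel_series.
  - by rewrite [ltRHS]ger0_norm// ltrDl.
by apply: (is_derive_eq H); rewrite bessel_coef_diffs// pseriesZ limZl_tmp.
Qed.

(** The recurrence J_nu(x) + J_(nu+2)(x) = (2 (nu + 1) / x) J_(nu+1)(x) in the variable u = x^2 /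
    4. *)
Lemma besselP_rec nu u : -1 < nu ->
  besselP nu u - besselP (nu + 1) u + u / ((nu + 1) * (nu + 2)) * besselP (nu + 2) u = 0.
Proof.
move=> nu1.
have c0 := @is_cvg_bessel_series nu u nu1.
have c1 := @is_cvg_bessel_series (nu + 1) u.
have c2 := @is_cvg_bessel_series (nu + 2) u.
have {}c1 := c1 ltac:(lra); have {}c2 := c2 ltac:(lra).
(* The factor [u] raises the degree by one, so the third partial sum stops one term earlier and the
   identity is exact. *)
have partial n : pseries (bessel_coef nu) u n.+1 - pseries (bessel_coef (nu + 1)) u n.+1
    + u / ((nu + 1) * (nu + 2)) * pseries (bessel_coef (nu + 2)) u n = 0.
  have recr c k : pseries c u k.+1 = pseries c u k + c k * u ^+ k by rewrite /pseries/= seriesSr.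
  elim: n => [|n IHn].
    by rewrite /pseries /series/= !big_nat1 big_geq// /bessel_coef /pochhammer !big_ord0; ring.
  rewrite (recr (bessel_coef nu)) (recr (bessel_coef (nu + 1))) (recr (bessel_coef (nu + 2))).
  rewrite mulrDr -[RHS]IHn /bessel_coef.
  have -> : pochhammer (nu + 1 + 1) n.+1 = (nu + 2) * pochhammer (nu + 2 + 1) n.
    rewrite pochhammerSl; congr (_ * pochhammer _ _); lra.
  have -> : pochhammer (nu + 1) n.+1 = (nu + 1) * (nu + 2) * pochhammer (nu + 2 + 1) n / (nu + 2 + n%:R).
    have E : pochhammer (nu + 2) n.+1 = (nu + 2) * pochhammer (nu + 2 + 1) n by rewrite pochhammerSl.
    have n2 : nu + 2 + n%:R != 0 by rewrite gt_eqF// ltr_pwDl//; lra.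
    rewrite -(mulrA (nu + 1)) -E [pochhammer (nu + 2) _]pochhammerSr pochhammerSl mulrA mulfK//.
    congr (_ * pochhammer _ _); lra.
  have A0 : pochhammer (nu + 2 + 1) n != 0 by rewrite gt_eqF// pochhammer_gt0//; lra.
  have fm : (n`!%:R : R) != 0 by rewrite pnatr_eq0 -lt0n fact_gt0.
  have n2 : nu + 2 + n%:R != 0 by rewrite gt_eqF// ltr_pwDl//; lra.
  have n1 : 1 + n%:R != 0 :> R by rewrite nat1r pnatr_eq0.
  rewrite factS natrM -nat1r !exprS; field.
  by rewrite n2 n1 fm A0/= !gt_eqF; lra.
have l : pseries (bessel_coef nu) u n.+1 - pseries (bessel_coef (nu + 1)) u n.+1
    + u / ((nu + 1) * (nu + 2)) * pseries (bessel_coef (nu + 2)) u n @[n --> \oo] -->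
  besselP nu u - besselP (nu + 1) u + u / ((nu + 1) * (nu + 2)) * besselP (nu + 2) u.
  apply: cvgD; last exact: cvgMl_tmp.
  by apply: cvgB; rewrite (cvg_shiftS (pseries _ u)).
rewrite -(cvg_lim _ l)//; apply/cvg_lim => //.
by under eq_fun do rewrite partial; exact: cvg_cst.
Qed.

Lemma besselJJE nu z : besselJJ nu z = besselP nu (z ^+ 2 / 4).
Proof.
rewrite /besselJJ /besselP /pseries; congr (limn (series _)); apply/funext => m.
rewrite /bessel_coef -mul2n exprM mulrAC; congr (_ * _ ^+ _).
by rewrite expr_div_n -natrX.
Qed.

Lemma besselJE nu x : -1 < nu -> 0 < x ->
  besselJ nu x = (x / 2) `^ nu / Gamma (nu + 1) * besselJJ nu x.
Proof.
move=> nu1 x0; have n0 : 0 < nu + 1 by lra.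
have x2 : 0 < x / 2 by rewrite divr_gt0.
rewrite besselJJE /besselP -[RHS]/(_ *: _) -limZl_tmp; last exact: is_cvg_bessel_series.
rewrite -pseriesZ /besselJ /pseries; congr (limn (series _)); apply/funext => m.
have g0 : Gamma (nu + 1) != 0 by rewrite gt_eqF ?Gamma_gt0.
have p0 : pochhammer (nu + 1) m != 0 by rewrite gt_eqF ?pochhammer_gt0.
have fm : (m`!%:R : R) != 0 by rewrite pnatr_eq0 -lt0n fact_gt0.
rewrite -[RHS]/((x / 2) `^ nu / Gamma (nu + 1) * bessel_coef nu m * (x ^+ 2 / 4) ^+ m).
rewrite /bessel_coef -addrA [m%:R + _]addrC Gamma_pochhammer//.
rewrite powRD; last by rewrite (gt_eqF x2) implybT.
rewrite powR_mulrn ?ltW// -mul2n exprM.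
have -> : x ^+ 2 / 4 = (x / 2) ^+ 2 by rewrite expr_div_n -natrX.
by field; rewrite g0 p0 fm.
Qed.

Lemma besselJ_eq0 nu x : -1 < nu -> 0 < x -> (besselJ nu x == 0) = (besselJJ nu x == 0).
Proof.
move=> nu1 x0; rewrite besselJE// mulf_eq0 gt_eqF// divr_gt0 ?powR_gt0 ?divr_gt0//.
by rewrite Gamma_gt0//; lra.
Qed.

End bessel_series.

(** * The transformed Bessel equation *)

Section transformed_bessel.
Context (R : realType) (nu lam : R).
Hypotheses (nu_gtN1 : -1 < nu) (nu_gt : 1 / 2 < `|nu|) (lam_gt0 : 0 < lam).
Let mu := `|nu|.
Let mu0 : 0 < mu. Proof. by rewrite (lt_trans _ nu_gt). Qed.

Let P u := besselP nu u.
Let D1 u := - (nu + 1)^-1 * besselP (nu + 1) u.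
Let D2 u := - (nu + 1)^-1 * (- (nu + 1 + 1)^-1 * besselP (nu + 1 + 1) u).

Let P_derive u : is_derive u (1 : R) P (D1 u).
Proof. exact: besselP_derive. Qed.

Let D1_derive u : is_derive u (1 : R) D1 (D2 u).
Proof.
have nu1 : -1 < nu + 1 by rewrite ltr_wpDr.
have H := derive_mulr (is_derive_cst (- (nu + 1)^-1) u 1) (besselP_derive u nu1).
by apply: (is_derive_eq H); rewrite mul0r add0r.
Qed.

(** Bessel's equation in the variable u = z^2 / 4. As the derivatives of [P] are multiples of the
    series of orders [nu + 1] and [nu + 2], it is the three-term recurrence. *)
Let bessel_ode u : u * D2 u + (nu + 1) * D1 u + P u = 0.
Proof.
have nu2 : nu + 1 + 1 = nu + 2 by ring.
rewrite -(besselP_rec u nu_gtN1) /P /D1 /D2 nu2; field.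
by have := nu_gtN1 => ?; rewrite !gt_eqF; lra.
Qed.

(** The argument of [P] after the substitution: with [lam] = z^2 / 4 and s = t^(2 mu) it equals (z
    t)^2 / 4. *)
Let w s := lam * s `^ mu^-1.

Let w_derive (s : R) : 0 < s -> is_derive s (1 : R) w (w s / (mu * s)).
Proof.
move=> s0; have H := derive_mulr (is_derive_cst lam s 1) (is_derive1_powR mu^-1 s0).
apply: (is_derive_eq H); rewrite mul0r add0r /w /cst powRB ?(gt_eqF s0) ?implybT//.
by rewrite powRr1 ?ltW//; field; rewrite !gt_eqF.
Qed.

Definition bessel_potential s := lam / mu ^+ 2 * s `^ (mu^-1 - 2).

(* Up to a constant factor, s^(1/2) J_nu(2 lam^(1/2) s^(1/(2|nu|))): the power of s
   collected is 1/2 + nu / (2|nu|), which is 1 for nu > 0 and 0 for nu < 0. *)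
Definition bessel_transform s := (if 0 < nu then s else 1) * P (w s).

Definition bessel_transform' s :=
  if 0 < nu then P (w s) + D1 (w s) * w s / mu else D1 (w s) * w s / (mu * s).

Lemma bessel_potentialE s : 0 < s -> bessel_potential s = w s / (mu * s) ^+ 2.
Proof.
move=> s0; rewrite /bessel_potential /w powRB ?(gt_eqF s0) ?implybT//.
by rewrite powR_mulrn ?ltW//; field; rewrite !gt_eqF.
Qed.

Lemma bessel_potential_gt0 s : 0 < s -> 0 < bessel_potential s.
Proof. by move=> s0; rewrite mulr_gt0 ?powR_gt0 ?divr_gt0 ?exprn_gt0. Qed.

Lemma bessel_potential_decr s t : 0 < s -> s < t -> bessel_potential t < bessel_potential s.
Proof.
move=> s0 st; rewrite ltr_pM2l ?divr_gt0 ?exprn_gt0//.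
have t0 := lt_trans s0 st.
(* The exponent of the potential is negative because [mu > 1 / 2]. *)
have r0 : 0 < 2 - mu^-1.
  by rewrite subr_gt0 invf_plt ?posrE//; move: nu_gt; rewrite div1r.
rewrite -opprB !powRN ltf_pV2 ?posrE ?powR_gt0//.
by apply: gt0_ltr_powR => //; rewrite nnegrE ltW.
Qed.

Lemma bessel_transform_derive (s : R) : 0 < s ->
  is_derive s (1 : R) bessel_transform (bessel_transform' s).
Proof.
move=> s0; rewrite /bessel_transform /bessel_transform'.
have dP := derive_compr (P_derive (w s)) (w_derive s0).
case: ifPn => nu0.
  apply: (is_derive_eq (derive_mulr (is_derive_id s 1) dP)).
  by field; rewrite !gt_eqF.
apply: (is_derive_eq (derive_mulr (is_derive_cst (1 : R) s 1) dP)).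
by rewrite /cst; field; rewrite !gt_eqF.
Qed.

Lemma bessel_transform'_derive (s : R) : 0 < s ->
  is_derive s (1 : R) bessel_transform' (- (bessel_potential s * bessel_transform s)).
Proof.
move=> s0; rewrite bessel_potentialE// /bessel_transform /bessel_transform'.
have dw := w_derive s0.
have dP := derive_compr (P_derive (w s)) dw.
have dD1w := derive_mulr (derive_compr (D1_derive (w s)) dw) dw.
(* Eliminating [P (w s)] leaves a rational identity that holds for [nu = mu] in one branch and for
   [nu = - mu] in the other. *)
have ode : P (w s) = - (w s * D2 (w s) + (nu + 1) * D1 (w s)).
  by have := bessel_ode (w s); lra.
case: ifPn => nu0.
  have numu : nu = mu by rewrite /mu gtr0_norm.
  apply: (is_derive_eq (derive_addr dP (derive_mulr dD1w (is_derive_cst mu^-1 s 1)))).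
  by rewrite ode numu /cst; field; rewrite !gt_eqF.
have numu : nu = - mu by rewrite /mu ler0_norm ?opprK// leNgt.
have ms : mu * s != 0 by rewrite mulf_neq0 ?gt_eqF.
apply: (is_derive_eq (derive_divr dD1w (derive_mulr (is_derive_cst mu s 1) (is_derive_id s 1)) ms)).
by rewrite ode {1}numu /cst; field; rewrite !gt_eqF.
Qed.

End transformed_bessel.

(* Up to a constant factor, t^(3|nu| - 1) J_nu(z t). *)
Definition bessel_weight (R : realType) (nu z t : R) : R :=
  t `^ (nu + 3 * `|nu| - 1) * besselJJ nu (z * t).

(** * Consecutive arches in the original variable *)

Section bessel_arch.
Context (R : realType) (nu z : R) (Phi : R -> R).
Hypotheses (nu_gtN1 : -1 < nu) (nu_gt : 1 / 2 < `|nu|) (z_gt0 : 0 < z).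
Hypothesis Phi_derive :
  forall t : R, 0 < t -> is_derive t (1 : R) Phi (bessel_weight nu z t).
Hypothesis Phi_cvg0 : Phi x @[x --> 0^'+] --> Phi 0.

Let mu := `|nu|.
Let mu0 : 0 < mu. Proof. by rewrite (lt_trans _ nu_gt). Qed.
Let lam := z ^+ 2 / 4.
Let lam0 : 0 < lam. Proof. by rewrite divr_gt0 ?exprn_gt0. Qed.
Let g := (2 * mu)^-1.
Let g0 : 0 < g. Proof. by rewrite invr_gt0 mulr_gt0. Qed.
Let gE : 2 * mu * g = 1.
Proof. by rewrite mulfV// gt_eqF ?mulr_gt0. Qed.

Let to_s (t : R) := t `^ (2 * mu).
Let to_t (s : R) := s `^ g.

Let to_sK t : 0 <= t -> to_t (to_s t) = t.
Proof. by move=> t0; rewrite /to_t /to_s -powRrM gE powRr1. Qed.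

Let to_s_lt : {in Num.nneg &, {homo to_s : x y / x < y}}.
Proof. by apply: gt0_ltr_powR; rewrite mulr_gt0. Qed.

Let to_t_lt : {in Num.nneg &, {homo to_t : x y / x < y}}.
Proof. exact: gt0_ltr_powR. Qed.

Let transformE s : 0 < s ->
  bessel_transform nu lam s = (if 0 < nu then s else 1) * besselJJ nu (z * to_t s).
Proof.
move=> s0; rewrite besselJJE /bessel_transform; congr (_ * besselP _ _).
rewrite exprMn [RHS]mulrAC; congr (_ * _); rewrite /to_t -powR_mulrn ?powR_ge0// -powRrM.
by congr (_ `^ _); rewrite /g invfM mulrC mulrA divff ?mul1r.
Qed.

Let sgnE s : 0 < s -> exists2 k, 0 < k & bessel_transform nu lam s = k * besselJJ nu (z * to_t s).
Proof.
move=> s0; exists (if 0 < nu then s else 1); last exact: transformE.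
by case: ifP.
Qed.

(** A sign factor, later a power of -1, that makes the arch under study positive. *)
Variable e : R.
Let y s := e * bessel_transform nu lam s.
Let v s := e * bessel_transform' nu lam s.
(** The factor [2 * mu] cancels the exponent [g] produced by the chain rule, so that [Psi] is a
    primitive of [y]. *)
Let Psi s := 2 * mu * e * Phi (to_t s).

Let y_derive (s : R) : 0 < s -> is_derive s (1 : R) y (v s).
Proof.
move=> s0; have H := bessel_transform_derive lam nu_gtN1 nu_gt s0.
apply: (is_derive_eq (derive_mulr (is_derive_cst e s 1) H)).
by rewrite mul0r add0r.
Qed.

Let v_derive (s : R) : 0 < s ->
  is_derive s (1 : R) v (- (bessel_potential nu lam s * y s)).
Proof.
move=> s0; have H := bessel_transform'_derive lam nu_gtN1 nu_gt s0.
apply: (is_derive_eq (derive_mulr (is_derive_cst e s 1) H)).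
by rewrite mul0r add0r /y /cst; ring.
Qed.

Let Psi_derive (s : R) : 0 < s -> is_derive s (1 : R) Psi (y s).
Proof.
move=> s0; have ts0 : 0 < to_t s by rewrite powR_gt0.
have H := derive_compr (Phi_derive ts0) (is_derive1_powR g s0).
apply: (is_derive_eq (derive_mulr (is_derive_cst (2 * mu * e) s 1) H)).
rewrite mul0r add0r /cst /y transformE// /bessel_weight -/mu.
transitivity ((2 * mu * g) * (e * ((to_t s) `^ (nu + 3 * mu - 1) * s `^ (g - 1) *
  besselJJ nu (z * to_t s)))); first ring.
rewrite gE mul1r; congr (_ * (_ * _)).
rewrite /to_t -powRrM -powRD; last by rewrite (gt_eqF s0) implybT.
(* The total exponent is 1 for [nu = mu] and 0 for [nu = - mu], matching the power of [s] collected
   in [bessel_transform]; this dictates the exponent of the weight. *)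
have -> : g * (nu + 3 * mu - 1) + (g - 1) = g * nu + 1 / 2.
  have -> : 1 / 2 = g * (3 * mu) - 1 by rewrite /g; field; rewrite gt_eqF.
  by ring.
case: ifPn => nu0.
  have -> : g * nu + 1 / 2 = 1.
    rewrite (_ : nu = mu); last by rewrite /mu gtr0_norm.
    by rewrite /g; field; rewrite gt_eqF.
  by rewrite powRr1// ltW.
have -> : g * nu + 1 / 2 = 0.
  rewrite (_ : nu = - mu); last by rewrite /mu ler0_norm ?opprK// leNgt.
  by rewrite /g; field; rewrite gt_eqF.
by rewrite powRr0.
Qed.

Let Psi_cvg a : 0 <= a -> Psi x @[x --> a^'+] --> Psi a.
Proof.
rewrite le_eqVlt => /predU1P[<-|a0]; last first.
  by apply: cvg_at_right_filter; exact: is_derive_continuous (Psi_derive a0).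
apply: cvgMl_tmp.
apply: (@increasing_cvg_at_right_comp _ to_t Phi 0 +oo%O).
- by [].
- by move=> s t /[!in_itv]/=; rewrite !andbT => s0 t0; apply: to_t_lt; rewrite nnegrE.
- by rewrite /to_t powR0 ?gt_eqF//; exact: powR_cvg0.
- by rewrite /to_t powR0 ?gt_eqF.
Qed.

(** [y] at [to_s t] is a positive multiple of [e * besselJJ nu (z * t)], so signs and zeros carry
    over to [s], where the Sturm comparison applies; [Psi] at [to_s t] is [2 * mu * e * Phi t],
    which brings the areas back. *)
Lemma bessel_arch a c b : 0 <= a -> a < c -> c < b ->
  (forall t, a < t < c -> 0 < e * besselJJ nu (z * t)) -> besselJJ nu (z * c) = 0 ->
  (forall t, c < t < b -> besselJJ nu (z * t) != 0) -> besselJJ nu (z * b) = 0 ->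
  (forall t, c < t < b -> e * besselJJ nu (z * t) < 0) /\
  e * (Phi c - Phi a) < e * (Phi c - Phi b).
Proof.
move=> a0 ac cb Jac Jc Jcb Jb.
have c0 := le_lt_trans a0 ac; have b0 := lt_trans c0 cb.
have sa0 : 0 <= to_s a by exact: powR_ge0.
have e0 : e != 0.
  have /Jac : a < (a + c) / 2 < c by rewrite !midf_lt.
  by apply: contraTneq => ->; rewrite mul0r ltxx.
have in_s t t1 t2 : 0 <= t1 -> t1 < t < t2 -> to_s t1 < to_s t < to_s t2.
  move=> t10 /andP[t1t tt2]; rewrite !to_s_lt// nnegrE ?(le_trans t10) ?ltW//.
  exact: lt_trans tt2.
have in_t s t1 t2 : 0 <= t1 -> 0 <= t2 -> to_s t1 < s < to_s t2 -> t1 < to_t s < t2.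
  move=> t10 t20 /andP[t1s st2]; have s0 : 0 <= s by rewrite (le_trans _ (ltW t1s)) ?powR_ge0.
  by rewrite -[X in X < _ < _]to_sK// -[X in _ < _ < X]to_sK// !to_t_lt// nnegrE ?powR_ge0.
have y1 s : to_s a < s < to_s c -> 0 < y s.
  move=> acs; have s0 : 0 < s by rewrite (le_lt_trans sa0)//; case/andP: acs.
  have [h h0 yh] := sgnE s0; rewrite /y yh mulrCA mulr_gt0// Jac// in_t// ltW//.
have y0 t : 0 < t -> besselJJ nu (z * t) = 0 -> y (to_s t) = 0.
  move=> t0 Jt; have st0 : 0 < to_s t by rewrite powR_gt0.
  have [h h0 yh] := sgnE st0.
  by rewrite /y yh to_sK ?(ltW t0)// Jt !mulr0.
have y2 s : to_s c < s < to_s b -> y s != 0.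
  move=> acs; have s0 : 0 < s by rewrite (@le_lt_trans _ _ (to_s c)) ?powR_ge0//; case/andP: acs.
  have [h h0 yh] := sgnE s0; rewrite /y yh !mulf_neq0// ?(gt_eqF h0)// Jcb// in_t// ltW//.
have sac : to_s a < to_s c by rewrite to_s_lt// nnegrE ltW.
have scb : to_s c < to_s b by rewrite to_s_lt// nnegrE ltW.
split.
  move=> t tcb; have t0 : 0 < t by rewrite (lt_trans c0)//; case/andP: tcb.
  have := sturm_alternate y_derive v_derive (bessel_potential_gt0 nu_gt lam0)
    sa0 sac scb y1 (y0 c c0 Jc) y2 (in_s _ _ _ (ltW c0) tcb).
  have st0 : 0 < to_s t by rewrite powR_gt0.
  have [h h0 yh] := sgnE st0.
  by rewrite /y yh to_sK ?(ltW t0)// mulrCA pmulr_rlt0.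
have := sturm_arch y_derive v_derive (bessel_potential_gt0 nu_gt lam0)
  (bessel_potential_decr nu_gt lam0) Psi_derive
  sa0 sac scb y1 (y0 c c0 Jc) y2 (y0 b b0 Jb) (Psi_cvg sa0).
rewrite /Psi (to_sK a0) (to_sK (ltW c0)) (to_sK (ltW b0)).
have mu2 : 0 < 2 * mu by rewrite mulr_gt0.
move=> H; rewrite -(ltr_pM2l mu2) !mulrBr !mulrA; exact: H.
Qed.

End bessel_arch.

Lemma integrableZ_EFin (R : realType) (D : set (measurableTypeR R)) (k : R) (f : R -> R) :
  measurable D ->
  (@lebesgue_measure R).-integrable D (EFin \o f) ->
  (@lebesgue_measure R).-integrable D (EFin \o (fun x => k * f x)).
Proof. by move=> mD fi; under [EFin \o _]eq_fun do rewrite /= EFinM; exact: integrableZl. Qed.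

(** * Alternating sums of arches *)

Section alternating_integral.
Context (R : realType) (h g phi Phi : R -> R) (c : nat -> R) (n : nat).
Local Notation mu := (@lebesgue_measure R).
Hypothesis c_lt : forall k, (k <= n)%N -> c k < c k.+1.
Hypothesis h_int : mu.-integrable `]c 0, c n.+1[ (EFin \o h).
Hypothesis phi_int : mu.-integrable `]c 0, c n.+1[ (EFin \o phi).
Hypothesis Phi_int : forall a b, c 0 <= a -> a < b -> b <= c n.+1 ->
  \int[mu]_(t in `]a, b[) phi t = Phi b - Phi a.
Hypothesis hE : forall t, c 0 < t < c n.+1 -> h t = g t * phi t.
Hypothesis g_gt0 : forall t, c 0 < t < c n.+1 -> 0 < g t.
Hypothesis g_nd : forall s t, c 0 < s -> s <= t -> t < c n.+1 -> g s <= g t.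
Hypothesis phi_sgn : forall k t, (k <= n)%N -> c k < t < c k.+1 -> 0 <= (-1) ^+ k * phi t.
Hypothesis Phi_first : forall t, c 0 < t < c 1 -> Phi t < Phi (c 1).
Hypothesis Phi_lobes : forall k, (k < n)%N ->
  (-1) ^+ k * (Phi (c k.+1) - Phi (c k)) < (-1) ^+ k * (Phi (c k.+1) - Phi (c k.+2)).

Let c_le i k : (i <= k)%N -> (k <= n.+1)%N -> c i <= c k.
Proof.
elim: k => [|k IHk]; first by rewrite leqn0 => /eqP->.
rewrite leq_eqVlt => /predU1P[->//|]; rewrite ltnS => ik kn.
by rewrite (le_trans (IHk ik (ltnW kn)))// ltW// c_lt.
Qed.

Let sub_itv a b : c 0 <= a -> b <= c n.+1 -> `]a, b[ `<=` `]c 0, c n.+1[.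
Proof. by move=> a0 b1; apply: subset_itv; rewrite bnd_simp. Qed.

(** As [e * phi] is nonnegative on the lobe, a bound on [g] can be taken out of the integral of
    [h = g * phi]. *)
Let lobe_lower e lo a b : c 0 <= a -> a < b -> b <= c n.+1 ->
  (forall t, a < t < b -> 0 <= e * phi t) -> (forall t, a < t < b -> lo <= g t) ->
  lo * (e * (Phi b - Phi a)) <= e * \int[mu]_(t in `]a, b[) h t.
Proof.
move=> a0 ab b1 ephi log.
have hi : mu.-integrable `]a, b[ (EFin \o h) by apply: integrableS h_int => //; exact: sub_itv.
have pi : mu.-integrable `]a, b[ (EFin \o phi) by apply: integrableS phi_int => //; exact: sub_itv.
rewrite -Phi_int// mulrA -!RintegralZl//; apply: le_Rintegral => //.
- exact: integrableZ_EFin.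
- exact: integrableZ_EFin.
move=> t; rewrite /= in_itv/= => tab; rewrite hE; last first.
  by case/andP: tab => at_ tb; rewrite (le_lt_trans a0)//= (lt_le_trans tb).
by rewrite mulrCA -mulrA ler_wpM2r ?ephi ?log.
Qed.

Let lobe_upper e hi a b : c 0 <= a -> a < b -> b <= c n.+1 ->
  (forall t, a < t < b -> 0 <= e * phi t) -> (forall t, a < t < b -> g t <= hi) ->
  e * \int[mu]_(t in `]a, b[) h t <= hi * (e * (Phi b - Phi a)).
Proof.
move=> a0 ab b1 ephi ghi.
have hi' : mu.-integrable `]a, b[ (EFin \o h) by apply: integrableS h_int => //; exact: sub_itv.
have pi : mu.-integrable `]a, b[ (EFin \o phi) by apply: integrableS phi_int => //; exact: sub_itv.
rewrite -Phi_int// mulrA -!RintegralZl//; apply: le_Rintegral => //.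
- exact: integrableZ_EFin.
- exact: integrableZ_EFin.
move=> t; rewrite /= in_itv/= => tab; rewrite hE; last first.
  by case/andP: tab => at_ tb; rewrite (le_lt_trans a0)//= (lt_le_trans tb).
by rewrite mulrCA -mulrA ler_wpM2r ?ephi ?ghi.
Qed.

Let split_int a b : c 0 < a -> a < b -> b <= c n.+1 ->
  \int[mu]_(t in `]c 0, b[) h t = \int[mu]_(t in `]c 0, a[) h t + \int[mu]_(t in `]a, b[) h t.
Proof.
move=> a0 ab b1.
rewrite -(@Rintegral_itvB _ h (BRight (c 0)) (BLeft b) a); last 3 first.
- by apply: integrableS h_int => //; exact: sub_itv.
- by rewrite bnd_simp ltW.
- by rewrite bnd_simp.
rewrite [X in _ = X + _]Rintegral_itv_bndo_bndc; first by rewrite subrKC.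
by apply: integrableS h_int => //; apply: sub_itv => //; rewrite (le_trans (ltW ab)).
Qed.

(* Each partial integral is squeezed between 0 and the last lobe, so that the
   next, larger lobe overrules it. *)
Lemma alternating_integral : 0 < (-1) ^+ n * \int[mu]_(t in `]c 0, c n.+1[) h t.
Proof.
pose T k := \int[mu]_(t in `]c 0, c k[) h t.
pose A k := (-1) ^+ k * (Phi (c k.+1) - Phi (c k)).
have c0k k : (k <= n)%N -> c 0 < c k.+1 by move=> kn; rewrite (le_lt_trans _ (c_lt kn))// c_le// ltnW.
(* The upper bound is restricted to [k < n]: at the last node [c n.+1] nothing is assumed about
   [g]. *)
suff H k : (k <= n)%N -> 0 < (-1) ^+ k * T k.+1 /\
    ((k < n)%N -> (-1) ^+ k * T k.+1 <= g (c k.+1) * A k).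
  by have [] := H n (leqnn n).
elim: k => [_|k IHk kn].
  have c1 : c 1 <= c n.+1 by exact: c_le.
  split=> [|n0]; last first.
    apply: lobe_upper => //; first exact: c_lt.
      by move=> t t01; exact: phi_sgn.
    move=> t /andP[t0 t1]; apply: g_nd => //; first exact: ltW.
    by rewrite (lt_le_trans (c_lt n0))// c_le.
  (* [g] may have no positive lower bound near [c 0]. Left of the midpoint the integral is merely
     nonnegative; right of it [g] is at least [g p]. *)
  pose p := (c 0 + c 1) / 2.
  have /andP[p0 p1] : c 0 < p < c 1 by rewrite !midf_lt ?c_lt.
  rewrite expr0 mul1r /T (split_int p0 p1 c1).
  have l1 := @lobe_lower 1 0 (c 0) p (lexx _) p0.
  have l2 := @lobe_lower 1 (g p) p (c 1) (ltW p0) p1 c1.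
  have phi0 t : c 0 < t < c 1 -> 0 <= 1 * phi t by move=> t01; have := phi_sgn (leq0n n) t01; rewrite expr0.
  rewrite !mul1r mul0r in l1 l2.
  apply: ltr_wpDl.
    apply: l1; first by rewrite ltW// (lt_le_trans p1).
      move=> t /andP[t0 tp]; apply: phi0; rewrite t0; exact: lt_trans p1.
    by move=> t /andP[t0 tp]; rewrite ltW// g_gt0// t0 (lt_le_trans tp)// ltW// (lt_le_trans p1).
  apply: lt_le_trans (l2 _ _).
  - by rewrite mulr_gt0 ?subr_gt0 ?Phi_first ?p0// g_gt0// p0 (lt_le_trans p1).
  - by move=> t /andP[tp t1]; apply: phi0; rewrite t1 (lt_trans p0).
  - by move=> t /andP[tp t1]; rewrite g_nd// ?(ltW tp)// (lt_le_trans t1).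
have [T0 /(_ kn) TA] := IHk (ltnW kn).
have ck2 : c k.+2 <= c n.+1 by exact: c_le.
have ck1 : c k.+1 < c k.+2 by exact: c_lt.
have cn1 : c k.+1 < c n.+1 by exact: lt_le_trans ck2.
have c01 := c0k k (ltnW kn).
have TE : (-1) ^+ k.+1 * T k.+2 =
    (-1) ^+ k.+1 * \int[mu]_(t in `]c k.+1, c k.+2[) h t - (-1) ^+ k * T k.+1.
  by rewrite /T (split_int c01 ck1 ck2) exprS; ring.
have sg t : c k.+1 < t < c k.+2 -> 0 <= (-1) ^+ k.+1 * phi t by exact: phi_sgn.
rewrite TE; split=> [|kn1].
  (* The new lobe is at least [g (c k.+1)] times its area under [phi]. That area exceeds [A k] by
     [Phi_lobes], so the bound [TA] on the previous partial integral is surpassed. *)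
  rewrite subr_gt0 (le_lt_trans TA)//.
  apply: lt_le_trans (lobe_lower (lo := g (c k.+1)) (ltW c01) ck1 ck2 sg _).
    rewrite ltr_pM2l; last by rewrite g_gt0// c01.
    by rewrite /A (lt_le_trans (Phi_lobes kn))// exprS mulN1r mulNr -mulrN opprB.
  by move=> t /andP[t1 t2]; rewrite g_nd// ?(ltW t1)// (lt_le_trans t2).
(* Dropping the subtracted positive term [(-1) ^+ k * T k.+1] leaves only the last lobe to bound. *)
rewrite (@le_trans _ _ ((-1) ^+ k.+1 * \int[mu]_(t in `]c k.+1, c k.+2[) h t))//.
  by rewrite gerBl ltW.
apply: lobe_upper => //; first exact: ltW.
move=> t /andP[t1 t2]; apply: g_nd; first exact: lt_trans t1.
  exact: ltW.
by rewrite (lt_le_trans (c_lt kn1))// c_le.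
Qed.

End alternating_integral.

(** * Regularity of the Bessel weight and integrability of the transform *)

Lemma besselP0 (R : realType) (nu : R) : besselP nu 0 = 1.
Proof.
apply/cvg_lim => //; apply: cvg_near_cst; near=> n.
have n0 : (0 < n)%N by near: n; exact: nbhs_infty_gt.
rewrite /pseries/= /series/= -(prednK n0) big_nat_recl//= big1_seq ?addr0.
  by rewrite expr0 mulr1 /bessel_coef /pochhammer big_ord0 fact0 !mulr1 divr1.
by move=> i _; rewrite exprS mul0r mulr0.
Unshelve. all: by end_near. Qed.

Lemma besselJJ_continuous (R : realType) (nu z : R) : -1 < nu ->
  continuous (fun t => besselJJ nu (z * t)).
Proof.
move=> nu1 t; under eq_fun do rewrite besselJJE expr2.
have d : is_derive t (1 : R) (fun t => z * t) z.
  apply: (is_derive_eq (derive_mulr (is_derive_cst z t 1) (is_derive_id t 1))).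
  by rewrite mul0r add0r mulr1.
have H := derive_mulr (derive_mulr d d) (is_derive_cst (4^-1 : R) t 1).
exact: is_derive_continuous (derive_compr (besselP_derive _ nu1) H).
Qed.

Section weight.
Context (R : realType) (nu z : R).
Hypotheses (nu_gtN1 : -1 < nu) (nu_gt : 1 / 2 < `|nu|).
Local Notation mu := (@lebesgue_measure R).
Let phi := bessel_weight nu z.

(** The exponent equals 4|nu| - 1 or 2|nu| - 1 according to the sign of [nu]; its positivity makes
    the weight continuous at 0. *)
Let expt_gt0 : 0 < nu + 3 * `|nu| - 1.
Proof.
have [nu0|nu0] := leP 0 nu.
  have := ger0_norm nu0; have := nu_gt; lra.
have := ltr0_norm nu0; have := nu_gt; lra.
Qed.

Lemma bessel_weight_continuous t : 0 < t -> {for t, continuous (bessel_weight nu z)}.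
Proof.
move=> t0; apply: cvgM; last exact: besselJJ_continuous.
exact: is_derive_continuous (is_derive1_powR _ t0).
Qed.

Lemma bessel_weight_integrable u : 0 < u -> mu.-integrable `[0, u] (EFin \o phi).
Proof.
move=> u0; apply: continuous_compact_integrable; first exact: segment_compact.
apply/continuous_within_itvP => //; split.
- by move=> t; rewrite in_itv/= => /andP[t0 _]; exact: bessel_weight_continuous.
- have -> : phi 0 = 0 * besselJJ nu (z * 0) by rewrite /phi /bessel_weight powR0 ?gt_eqF.
  apply: cvgM; first exact: powR_cvg0.
  by apply: cvg_at_right_filter; exact: besselJJ_continuous.
- by apply: cvg_at_left_filter; exact: bessel_weight_continuous.
Qed.

Definition bessel_primitive (t : R) : R := \int[mu]_(x in `[0, t]) phi x.

Lemma bessel_primitive_derive (t : R) : 0 < t ->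
  is_derive t (1 : R) bessel_primitive (phi t).
Proof.
move=> t0; have t1 : 0 < t + 1 by rewrite addr_gt0.
have tt1 : t < t + 1 by rewrite ltrDl.
have [d dE] := continuous_FTC1_closed tt1
  (bessel_weight_integrable t1) t0 (bessel_weight_continuous t0).
by apply: DeriveDef => //; rewrite -derive1E.
Qed.

Lemma bessel_primitive_cvg0 : bessel_primitive x @[x --> 0^'+] --> bessel_primitive 0.
Proof.
rewrite {2}/bessel_primitive set_itv1 Rintegral_set1.
apply: cvg_at_right_filter.
exact: (parameterized_integral_cvg_left ltr01 (bessel_weight_integrable ltr01)).
Qed.

Lemma bessel_primitiveB a b : 0 <= a -> a < b ->
  \int[mu]_(t in `]a, b[) phi t = bessel_primitive b - bessel_primitive a.
Proof.
move=> a0 ab; have b0 := le_lt_trans a0 ab.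
rewrite /bessel_primitive (@Rintegral_itvB _ _ (BLeft 0) (BRight b) a)//.
  rewrite Rintegral_itv_bndo_bndc//.
  apply: integrableS (bessel_weight_integrable b0) => //.
  by apply: subset_itv; rewrite bnd_simp.
- exact: bessel_weight_integrable.
- by rewrite bnd_simp ltW.
Qed.

End weight.

(** On the unit interval the Bessel factor is bounded by continuity. For [nu >= - (1 / 2)] the power
    of [t] is at most 1, so [f] dominates its product with the power; otherwise the extra hypothesis
    gives the integrability of that product. *)
Lemma hankel_integrable (R : realType) (nu z : R) (f : R -> R) :
  -1 < nu -> 
  (@lebesgue_measure R).-integrable `]0, 1[ (fun t : R => (f t)%:E) ->
  (nu < - (1 / 2) ->
    (\int[@lebesgue_measure R]_(t in `]0%R, 1%R[)
       (t `^ (nu + 1 / 2) * `|f t|)%:E < +oo)%E) ->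
  (@lebesgue_measure R).-integrable `]0, 1[
    (EFin \o (fun t => t `^ (nu + 1 / 2) * f t * besselJJ nu (z * t))).
Proof.
move=> nu1 fi fi'.
pose D : set (measurableTypeR R) := [set` `]0%R, 1%R[%R].
have mf : measurable_fun D f by apply/measurable_EFinP; exact: (measurable_int _ fi).
have mk : measurable_fun D (fun t => t `^ (nu + 1 / 2) * f t).
  by apply: measurable_funM => //; apply: measurable_funTS; exact: measurable_powR.
have ki : (@lebesgue_measure R).-integrable D (EFin \o (fun t => t `^ (nu + 1 / 2) * f t)).
  have [nuh|/fi' If] := leP (- (1 / 2)) nu.
    apply: le_integrable fi => //; first exact/measurable_EFinP.
    move=> t; rewrite /= in_itv/= => /andP[t0 t1]; rewrite lee_fin normrM ler_piMl//.
    rewrite ger0_norm ?powR_ge0// -[leRHS](powRr0 t); apply: ger_powR; last lra.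
    by rewrite t0 ltW.
  apply/integrableP; split; first exact/measurable_EFinP.
  apply: le_lt_trans If; rewrite le_eqVlt; apply/orP; left; apply/eqP.
  apply: eq_integral => t _.
  by rewrite /= normrM (ger0_norm (powR_ge0 _ _)).
have cJ := besselJJ_continuous (z := z) nu1.
have [M JM] : exists M, forall t, 0 < t < 1 -> `|besselJJ nu (z * t)| <= M.
  have cN : {within `[0, 1], continuous (fun t => `|besselJJ nu (z * t)|)}.
    by apply: continuous_subspaceT => t; apply: cvg_norm; exact: cJ.
  have [c _ cM] := EVT_max ler01 cN.
  exists (`|besselJJ nu (z * c)|) => t /andP[t0 t1].
  by apply: cM; rewrite in_itv/= !ltW.
have M0 : 0 <= M by apply: le_trans (JM (1 / 2) _); [exact: normr_ge0|lra].
have mD : measurable D by exact: measurable_itv.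
apply: le_integrable (integrableZ_EFin M mD ki) => //.
  apply/measurable_EFinP; apply: measurable_funM => //.
  by apply: measurable_funTS; exact: continuous_measurable_fun.
move=> t; rewrite /D/= in_itv/= => t01; rewrite lee_fin normrM mulrC [leRHS]normrM.
by rewrite ler_wpM2r// (ger0_norm M0) JM.
Qed.

(** * Rescaled zeros and the sign of the transform *)

Theorem lemma6p2 (R : realType) (nu : R) (f : R -> R) (j : nat -> R)
  (hnu : -1 < nu) (hnu2 : 1 / 2 < `|nu|)
  (hj : bessel_zeros nu j)
  (fpos : forall t : R, 0 < t -> t < 1 -> 0 < f t)
  (fint : (@lebesgue_measure R).-integrable `]0, 1[ (fun t : R => (f t)%:E))
  (fint' : nu < - (1 / 2) ->
    (\int[@lebesgue_measure R]_(t in `]0%R, 1%R[)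
       (t `^ (nu + 1 / 2) * `|f t|)%:E < +oo)%E)
  (finc : forall s t : R, 0 < s -> s <= t -> t < 1 ->
    s `^ (3 / 2 - 3 * `|nu|) * f s <= t `^ (3 / 2 - 3 * `|nu|) * f t) :
  forall m : nat, (1 <= m)%N -> Num.sg (hankelH nu f (j m)) = (-1) ^+ m.+1.
Proof.
case=> // n _; have [j_lt j_zeros] := hj.
set z := j n.+1.
have j_pos k : (0 < k)%N -> 0 < j k.
  by move=> k0; have [_ /(_ (ex_intro2 _ _ k k0 erefl))[]] := j_zeros (j k).
have z0 : 0 < z by exact: j_pos.
(* The zeros divided by [z], so that [c n.+1 = 1]; the node [c 0] is set to 0, in place of the
   irrelevant [j 0]. *)
pose c k : R := if k is 0 then 0 else j k / z.
have c0 : c 0%N = 0 by [].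
have cn : c n.+1 = 1 by rewrite /c divff// gt_eqF.
have c_lt k : c k < c k.+1.
  by case: k => [|k]; rewrite /c ?divr_gt0 ?j_pos// ltr_pM2r ?invr_gt0// j_lt.
have c_ge0 k : 0 <= c k by case: k => // k; rewrite /c divr_ge0 ?ltW ?j_pos.
have zc k : z * c k.+1 = j k.+1 by rewrite /c mulrC divfK// gt_eqF.
have J_c k : besselJJ nu (z * c k.+1) = 0.
  apply/eqP; rewrite zc -besselJ_eq0 ?j_pos//; apply/eqP.
  by have [_ /(_ (ex_intro2 _ _ k.+1 isT erefl))[]] := j_zeros (j k.+1).
have J_n0 k t : c k < t < c k.+1 -> besselJJ nu (z * t) != 0.
  move=> /andP[kt tk]; have t0 : 0 < t by exact: le_lt_trans kt.
  have zt0 : 0 < z * t by rewrite mulr_gt0.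
  rewrite -besselJ_eq0//; apply/eqP => Jt.
  (* A further zero would be some [j i]: with [i <= k] it lies too far left, with [i > k] too far
     right. *)
  have [/(_ (conj zt0 Jt))[i i0 ji] _] := j_zeros (z * t).
  have ztk : z * t < j k.+1 by rewrite -zc ltr_pM2l.
  have [ik|ki] := leqP i k.
    have k0 : (0 < k)%N by exact: leq_trans ik.
    have : j i <= j k.
      by move: ik; rewrite leq_eqVlt => /predU1P[->//|ik]; rewrite ltW// j_lt.
    rewrite ji leNgt => /negP; apply.
    by rewrite -(prednK k0) -zc ltr_pM2l// prednK.
  have : j k.+1 <= j i.
    by move: ki; rewrite leq_eqVlt => /predU1P[<-//|ki]; rewrite ltW// j_lt.
  by rewrite ji leNgt ztk.
pose Phi := bessel_primitive nu z.
have Phi_derive (t : R) : 0 < t -> is_derive t (1 : R) Phi (bessel_weight nu z t).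
  by move=> t0; exact: bessel_primitive_derive.
have Phi_cvg0 := @bessel_primitive_cvg0 R nu z hnu hnu2.
have arch := bessel_arch hnu hnu2 z0 Phi_derive Phi_cvg0.
(* Induction on the lobe: the first is positive since the function is 1 at 0 and has no zero before
   [c 1]; each next sign comes from [bessel_arch]. *)
have J_sgn k t : c k < t < c k.+1 -> 0 < (-1) ^+ k * besselJJ nu (z * t).
  elim: k t => [|k IHk] t tk; last first.
    have := (arch _ _ _ _ (c_ge0 k) (c_lt k) (c_lt k.+1) IHk (J_c k) (J_n0 k.+1) (J_c k.+1)).1 t tk.
    by rewrite exprS mulN1r mulNr oppr_gt0.
  have /andP[t0 t1] := tk; rewrite expr0 mul1r ltNge le_eqVlt negb_or (J_n0 0%N)//=.
  apply/negP => Jt.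
  have [||u] := @IVT R (fun t => besselJJ nu (z * t)) 0 t 0 (ltW t0).
  - by apply: continuous_subspaceT; exact: besselJJ_continuous.
  - have J1 := le_trans (ltW Jt) ler01.
    by rewrite mulr0 [besselJJ nu 0]besselJJE expr0n mul0r besselP0 min_r// max_l// ler01 ltW.
  rewrite in_itv/= => /andP[]; rewrite le_eqVlt => /predU1P[<- _|u0 ut].
    by rewrite mulr0 besselJJE expr0n mul0r besselP0 => /eqP; rewrite oner_eq0.
  by move/eqP; apply/negP; apply: (J_n0 0%N); rewrite u0 (le_lt_trans ut).
pose g t := t `^ (3 / 2 - 3 * `|nu|) * f t.
have hE t : 0 < t -> t `^ (nu + 1 / 2) * f t * besselJJ nu (z * t) = g t * bessel_weight nu z t.
  move=> t0; rewrite /g /bessel_weight.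
  have -> : nu + 1 / 2 = (3 / 2 - 3 * `|nu|) + (nu + 3 * `|nu| - 1) by lra.
  rewrite [in LHS]powRD ?(gt_eqF t0) ?implybT//; ring.
have main : 0 < (-1) ^+ n * hankelH nu f z.
  have -> : hankelH nu f z = \int[@lebesgue_measure R]_(t in `]c 0%N, c n.+1[)
      (t `^ (nu + 1 / 2) * f t * besselJJ nu (z * t)) by rewrite c0 cn.
  apply: (@alternating_integral _ _ g (bessel_weight nu z) Phi c n).
  - by move=> k _; exact: c_lt.
  - by rewrite c0 cn; exact: hankel_integrable.
  - rewrite c0 cn; apply: integrableS (@bessel_weight_integrable R nu z hnu hnu2 1 ltr01) => //.
    by apply: subset_itv; rewrite bnd_simp.
  - by move=> a b a0 ab _; exact: bessel_primitiveB.
  - by move=> t /andP[t0 _]; exact: hE.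
  - by move=> t; rewrite c0 cn => /andP[t0 t1]; rewrite mulr_gt0 ?powR_gt0 ?fpos.
  - by rewrite c0 cn; exact: finc.
  - move=> k t _ tk; rewrite /bessel_weight mulrCA mulr_ge0 ?powR_ge0// ltW//.
    exact: J_sgn tk.
  - move=> t /andP[t0 t1]; apply: (is_derive_lt t1) => u /andP[tu u1].
      by apply: Phi_derive; exact: lt_le_trans tu.
    have u0 : 0 < u by exact: lt_trans tu.
    rewrite mulr_gt0 ?powR_gt0//.
    by have := @J_sgn 0%N u; rewrite expr0 mul1r; apply; rewrite c0 u0.
  - move=> k _.
    exact: (arch _ _ _ _ (c_ge0 k) (c_lt k) (c_lt k.+1) (J_sgn k) (J_c k) (J_n0 k.+1) (J_c k.+1)).2.
(* With [m = n.+1] the expected sign [(-1) ^+ n.+2] equals [(-1) ^+ n]. *)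
move/gtr0_sg: main; rewrite sgrM sgrX sgrN1 => sg1.
by rewrite !exprS !mulN1r opprK -[RHS]mulr1 -[X in _ = _ * X]sg1 mulrA -expr2 sqrr_sign mul1r.
Qed.
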